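(* Let $M$ be a C*-ternary ring with Zettl decomposition $M=M_+\oplus M_-$. Then the Banach algebra $\mathcal B=\mathcal A(M_-)$ is semisimple. Hence all C*-ternary rings and all anti-C*-algebras are semisimple.
   Context: An associative triple system (of the second kind) is a complex vector space $M$ with a map $(x,y,z)\mapsto[xyz]$, $M^3\to M$, linear in $x$ and $z$, conjugate-linear in $y$, with $[[xyz]uv]=[x[uzy]v]=[xy[zuv]]$. A C*-ternary ring is an associative triple system that is also a complex Banach space with $\|[xyz]\|\le\|x\|\|y\|\|z\|$ and $\|[xxx]\|=\|x\|^3$. A TRO (ternary ring of operators) is a norm-closed subspace $V\subset B(H,K)$ ($H,K$ Hilbert spaces) with $VV^*V\subset V$; it is a C*-ternary ring under $[xyz]=xy^*z$. An anti-TRO is such a subspace considered as a C*-ternary ring under $[xyz]=-xy^*z$. Zettl decomposition (known): every C*-ternary ring is uniquely a direct sum $M=M_+\oplus M_-$ of sub-C*-ternary rings with $M_+$ isomorphic (isometrically, preserving triple products) to a TRO and $M_-$ to an anti-TRO. Normed standard embedding. For $g,h\in M$ put $\ell(g,h)=([gh\,\cdot],[hg\,\cdot])$ and $r(g,h)=([\,\cdot\, gh],[\,\cdot\, hg])$, pairs of operators on $M$. On pairs $A=(A_1,A_2)$ scalars act by $\lambda(A_1,A_2)=(\lambda A_1,\overline\lambda A_2)$, and $\overline{(A_1,A_2)}=(A_2,A_1)$. Let $L_0(M)=\operatorname{span}\{\ell(g,h)\}$ with product $AA'=(A_1A_1',A_2'A_2)$ and $R_0(M)=\operatorname{span}\{r(g,h)\}$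 with product $B\circ B'=(B_1'B_1,B_2B_2')$. Let $L(M)$, $R(M)$ be the closures of $L_0(M)$, $R_0(M)$ in $B(M\oplus M)$, the pair $(A_1,A_2)$ acting diagonally ($M\oplus M$ with the max norm). Let $\overline M=\{\overline f:f\in M\}$ be the conjugate space of $M$ ($\lambda\overline f=\overline{\overline\lambda f}$). Actions: $A\cdot f=A_1f$, $f\cdot B=B_1f$, $B\cdot\overline f=\overline{B_2f}$, $\overline f\cdot A=\overline{A_2f}$. $\mathcal A(M)$ is the space of matrices $\begin{bmatrix}A&f\\ \overline g&B\end{bmatrix}$ with $A\in L(M)$, $f,g\in M$, $B\in R(M)$, with product $$\begin{bmatrix}A&f\\ \overline g&B\end{bmatrix}\begin{bmatrix}A'&f'\\ \overline{g'}&B'\end{bmatrix}=\begin{bmatrix}AA'+\ell(f,g')&A\cdot f'+f\cdot B'\\ \overline g\cdot A'+B\cdot\overline{g'}&r(g,f')+B\circ B'\end{bmatrix}$$ and involution $\begin{bmatrix}A&f\\ \overline g&B\end{bmatrix}^\#=\begin{bmatrix}\overline A&g\\ \overline f&\overline B\end{bmatrix}$. It is a Banach algebra in a norm equivalent to $\max(\|A\|,\|f\|,\|g\|,\|B\|)$. An anti-C*-algebra is a Banach algebra of the form $\mathcal A(N)$ for some anti-TRO $N$ (equivalently $\mathcal A(M_-)$ for some C*-ternary ring $M$). Semisimplicity. The (Jacobson) radical of an associative triple system $M$ is the set of $x\in M$ such that for every $u\in M$ there is $y\in M$ with $y-x=[yux]=[xuy]$; a C*-ternary ring is semisimple if its radical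 is $0$. The Jacobson radical of an associative algebra $A$ is the set of $x\in A$ such that for every $u\in A$ there is $y\in A$ with $y-x=xuy=yux$; $A$ is semisimple if this is $0$. *)

(* Defs.v *)
From HB Require Import structures.
From mathcomp Require Import all_boot all_order all_algebra.
From mathcomp Require Import sesquilinear complex.
From mathcomp Require Import all_classical all_reals all_analysis.

Set Implicit Arguments.
Unset Strict Implicit.
Unset Printing Implicit Defensive.

Import Order.TTheory GRing.Theory Num.Theory.
Import numFieldNormedType.Exports.

Local Open Scope classical_set_scope.
Local Open Scope complex_scope.
Local Open Scope ring_scope.

(* [tp x y z] is the triple product [xyz]; [a^*] is complex conjugation. *)
HB.mixin Record isAssocTriple (C : numClosedFieldType) M & GRing.Lmodule C M := {
  tp : M -> M -> M -> M ;
  tp_linearl : forall y z, linear (fun x => tp x y z) ;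
  tp_conjlinear : forall x z (a : C) y y',
    tp x (a *: y + y') z = a^* *: tp x y z + tp x y' z ;
  tp_linearr : forall x y, linear (tp x y) ;
  tp_assocm : forall x y z u v, tp (tp x y z) u v = tp x (tp u z y) v ;
  tp_assocr : forall x y z u v, tp (tp x y z) u v = tp x y (tp z u v)
}.

#[short(type="assocTripleType")]
HB.structure Definition AssocTriple (C : numClosedFieldType) :=
  {M of GRing.Lmodule C M & isAssocTriple C M}.

HB.mixin Record AssocTriple_isCstarTernary (C : numClosedFieldType) M
    & CompleteNormedModule C M & AssocTriple C M := {
  norm_tp_le : forall x y z : M, `|tp x y z| <= `|x| * `|y| * `|z| ;
  norm_tp_cube : forall x : M, `|tp x x x| = `|x| ^+ 3
}.

#[short(type="cstarTernaryType")]
HB.structure Definition CstarTernary (C : numClosedFieldType) :=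
  {M of CompleteNormedModule C M & AssocTriple C M & AssocTriple_isCstarTernary C M}.

Section norm_Re.
Variables (R : realType).
Lemma norm_ReE (V : normedModType R[i]) (x : V) : (complex.Re `|x|)%:C = `|x|.
Proof. by apply/eqP; rewrite eq_complex /= eqxx /=; have := normr_ge0 x; rewrite lecE /= => /andP[/eqP->]. Qed.

Lemma norm_Re_ge0 (V : normedModType R[i]) (x : V) : 0 <= complex.Re `|x|.
Proof. by have := normr_ge0 x; rewrite lecE /= => /andP[]. Qed.

Lemma ReM_ge0l (a b : R[i]) : 0 <= a -> complex.Re (a * b) = complex.Re a * complex.Re b.
Proof. by case: a b => [a a'] [b b'] /ger0_Im /= ->; rewrite mul0r subr0. Qed.

Lemma Re_le (a b : R[i]) : a <= b -> complex.Re a <= complex.Re b.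
Proof. by rewrite lecE => /andP[]. Qed.
End norm_Re.

Section bounded_operators.
Variables (R : realType) (E F : normedModType R[i]).

Definition bounded_op : pred (E -> F) :=
  fun f => `[< linear f /\ exists c : R[i], forall x, `|f x| <= c * `|x| >].

Record bop := Bop { bop_fun :> E -> F ; bopP : bounded_op bop_fun }.

HB.instance Definition _ := [isSub for bop_fun].
HB.instance Definition _ := [Choice of bop by <:].

Lemma bounded_opP (f : E -> F) :
  reflect (linear f /\ exists2 c : R, 0 <= c & forall x, `|f x| <= c%:C * `|x|)
          (bounded_op f).
Proof.
apply: (iffP (asboolP _)) => -[lf [c]]; last by move=> _ cf; split=> //; exists c%:C.
move=> cf; split=> //; exists `|complex.Re c| => // x.
have := Re_le (cf x); rewrite mulrC ReM_ge0l// => h.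
rewrite -[`|f x|]norm_ReE -[`|x|]norm_ReE -rmorphM lecR (le_trans h)// mulrC.
by apply: ler_wpM2r; rewrite ?norm_Re_ge0 ?ler_norm.
Qed.

Lemma bounded_op_submod : submod_closed bounded_op.
Proof.
split.
  apply/bounded_opP; split=> [a x y|]; first by rewrite /= scaler0 addr0.
  by exists 0 => // x; rewrite normr0 mul0r.
move=> a f g /bounded_opP[lf [c c0 cf]] /bounded_opP[lg [d d0 dg]].
apply/bounded_opP; split=> [b x y|].
  rewrite -[LHS]/(a *: f (b *: x + y) + g (b *: x + y)).
  rewrite -[RHS]/(b *: (a *: f x + g x) + (a *: f y + g y)).
  rewrite lf lg !scalerDr !scalerA mulrC -!addrA; congr (_ + _).
  by rewrite !addrA (addrC (a *: f y)).
exists (complex.Re `|a| * c + d) => [|x]; first by rewrite addr_ge0 ?mulr_ge0 // (@norm_Re_ge0 R (R[i])^o).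
rewrite (le_trans (ler_normD _ _))//= rmorphD mulrDl lerD// normrZ.
rewrite rmorphM /= (@norm_ReE R (R[i])^o) -mulrA.
exact: ler_wpM2l.
Qed.
HB.instance Definition _ := GRing.isSubmodClosed.Build _ _ bounded_op
  bounded_op_submod.
HB.instance Definition _ := [SubChoice_isSubLmodule of bop by <:].

(* Norms of complex normed modules are [R[i]]-valued, hence the real parts and
   the injection of the supremum of the reals back into [R[i]]. *)
Definition opnorm (f : bop) : R[i] :=
  (sup [set complex.Re `|f x| | x in [set x | `|x| <= 1]])%:C.

Lemma bop_linear (f : bop) : linear f.
Proof. by case/bounded_opP: (bopP f). Qed.
HB.instance Definition _ (f : bop) :=
  GRing.isLinear.Build _ _ _ _ (bop_fun f) (bop_linear f).

Lemma opnorm_has_sup (f : bop) :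
  has_sup [set complex.Re `|f x| | x in [set x | `|x| <= 1]].
Proof.
split; first by exists (complex.Re `|f 0|), 0 => //=; rewrite normr0 ler01.
case/bounded_opP: (bopP f) => _ [c c0 cf]; exists c => _ [x /= x1 <-].
have /Re_le := cf x; rewrite ReM_ge0l ?lecR//= => /le_trans; apply.
by rewrite -[leRHS]mulr1 ler_wpM2l //; exact: (Re_le x1).
Qed.

Lemma opnorm_ge0 f : 0 <= opnorm f.
Proof.
rewrite lecR; apply: (@le_trans _ _ (complex.Re `|f 0|)); first exact: norm_Re_ge0.
apply: sup_ubound; first by case: (opnorm_has_sup f).
by exists 0 => //=; rewrite normr0 ler01.
Qed.

Lemma opnormP (f : bop) x : `|f x| <= opnorm f * `|x|.
Proof.
have [->|x0] := eqVneq x 0; first by rewrite linear0 !normr0 mulr0.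
have nx0 : 0 < `|x| by rewrite normr_gt0.
rewrite -ler_pdivrMr// mulrC -[X in X * _]ger0_norm ?invr_ge0// -normrZ -linearZ /=.
rewrite -[X in X <= _]norm_ReE /opnorm lecR; apply: sup_ubound; first by case: (opnorm_has_sup f).
exists (`|x|^-1 *: x) => //=.
by rewrite normrZ ger0_norm ?invr_ge0// mulVf ?gt_eqF.
Qed.

Lemma opnorm_le (f : bop) (c : R[i]) : 0 <= c -> (forall x, `|f x| <= c * `|x|) -> opnorm f <= c.
Proof.
move=> c0 cf; have cE : c = (complex.Re c)%:C.
  by apply/eqP; rewrite eq_complex /= eqxx (ger0_Im c0) eqxx.
rewrite cE /opnorm lecR; apply: ge_sup; first by case: (opnorm_has_sup f).
move=> _ [x /= x1 <-]; apply: Re_le; apply: (le_trans (cf x)).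
by rewrite -[leRHS]mulr1 ler_wpM2l.
Qed.

Lemma bop_eqP (f g : bop) : (forall x, f x = g x) -> f = g.
Proof. by move=> fg; apply/val_inj/funext. Qed.

Lemma opnormD f g : opnorm (f + g) <= opnorm f + opnorm g.
Proof.
apply: opnorm_le => [|x]; first by rewrite addr_ge0 ?opnorm_ge0.
by rewrite (le_trans (ler_normD _ _))// mulrDl lerD// opnormP.
Qed.

Lemma opnormZ_le a f : opnorm (a *: f) <= `|a| * opnorm f.
Proof.
apply: opnorm_le => [|x]; first by rewrite mulr_ge0 ?opnorm_ge0.
by rewrite normrZ -mulrA ler_wpM2l// opnormP.
Qed.

Lemma opnormZ a f : opnorm (a *: f) = `|a| * opnorm f.
Proof.
apply/eqP; rewrite eq_le opnormZ_le/=.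
have [->|a0] := eqVneq a 0; first by rewrite normr0 mul0r opnorm_ge0.
rewrite -ler_pdivlMl ?normr_gt0// -normfV.
by have := opnormZ_le a^-1 (a *: f); rewrite scalerA mulVf// scale1r.
Qed.

Lemma opnorm0_eq0 f : opnorm f = 0 -> f = 0.
Proof.
move=> f0; apply: bop_eqP => x; apply/eqP; rewrite -normr_le0.
by rewrite (le_trans (opnormP f x))// f0 mul0r.
Qed.

HB.instance Definition _ :=
  Lmodule_isNormed.Build R[i] bop opnormD opnormZ opnorm0_eq0.

Lemma bop_normE (f : bop) : `|f| = opnorm f.
Proof. by []. Qed.

End bounded_operators.

Section bop_comp.
Variables (R : realType) (E F G : normedModType R[i]).

Lemma bounded_op_comp (S : bop F G) (T : bop E F) : bounded_op (S \o T).
Proof.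
apply/asboolP; split=> [a x y|]; first by rewrite /= !linearP.
exists (opnorm S * opnorm T) => x /=; rewrite (le_trans (opnormP S _))// -mulrA.
by rewrite ler_wpM2l ?opnorm_ge0// opnormP.
Qed.

Definition bcomp (S : bop F G) (T : bop E F) : bop E G := Bop (bounded_op_comp S T).

Lemma norm_bcomp S T : `|bcomp S T| <= `|S| * `|T|.
Proof.
apply: opnorm_le => [|x]; first by rewrite mulr_ge0.
rewrite /= (le_trans (opnormP S _))// -mulrA.
by rewrite ler_wpM2l ?opnorm_ge0// opnormP.
Qed.

Lemma bcompDl S S' T : bcomp (S + S') T = bcomp S T + bcomp S' T.
Proof. exact: bop_eqP. Qed.

Lemma bcompDr S T T' : bcomp S (T + T') = bcomp S T + bcomp S T'.
Proof. by apply: bop_eqP => x; rewrite /= [LHS]linearD. Qed.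

Lemma bcompZl a S T : bcomp (a *: S) T = a *: bcomp S T.
Proof. exact: bop_eqP. Qed.

Lemma bcompZr a S T : bcomp S (a *: T) = a *: bcomp S T.
Proof. by apply: bop_eqP => x; rewrite /= [LHS]linearZ. Qed.

End bop_comp.

Definition linear_subset (K : pzRingType) (V : lmodType K) (S : set V) :=
  S 0 /\ forall a x y, S x -> S y -> S (a *: x + y).

Lemma linear_subset_submod (K : pzRingType) (V : lmodType K) (S : set V) :
  linear_subset S -> submod_closed (fun x => `[< S x >]).
Proof.
move=> [S0 SD]; split=> [|a x y /asboolP Sx /asboolP Sy]; first exact/asboolP.
by apply/asboolP; exact: SD.
Qed.

Record sub_cstar (C : numClosedFieldType) (M : cstarTernaryType C) := SubCstar {
  sub_set : set M ;
  sub_closed : closed sub_set ;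
  sub_linear : linear_subset sub_set ;
  sub_tp : forall x y z, sub_set x -> sub_set y -> sub_set z -> sub_set (tp x y z)
}.

(* A sub-C*-ternary ring [S] of [M] as a C*-ternary ring [sub_cstar_type S] in its own
   right, with the restricted norm and triple product. *)
Section sub_cstar_ring.
Variables (C : numClosedFieldType) (M : cstarTernaryType C) (S : sub_cstar M).

Definition sub_cstar_mem : pred M := fun x => `[< sub_set S x >].

Record sub_cstar_type := SubElt { sub_val :> M ; sub_valP : sub_cstar_mem sub_val }.

HB.instance Definition _ := [isSub for sub_val].
HB.instance Definition _ := [Choice of sub_cstar_type by <:].
HB.instance Definition _ := GRing.isSubmodClosed.Build _ _ sub_cstar_mem
  (linear_subset_submod (sub_linear S)).
HB.instance Definition _ := [SubChoice_isSubLmodule of sub_cstar_type by <:].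

Let subnorm (x : sub_cstar_type) : C := `|sub_val x|.

Let subnormD (x y : sub_cstar_type) : subnorm (x + y) <= subnorm x + subnorm y.
Proof. exact: ler_normD. Qed.
Let subnormZ a (x : sub_cstar_type) : subnorm (a *: x) = `|a| * subnorm x.
Proof. exact: normrZ. Qed.
Let subnorm0_eq0 x : subnorm x = 0 -> x = 0.
Proof. by move=> /normr0_eq0 x0; apply: val_inj. Qed.

HB.instance Definition _ :=
  Lmodule_isNormed.Build C sub_cstar_type subnormD subnormZ subnorm0_eq0.

Lemma sub_complete (F : set_system sub_cstar_type) : ProperFilter F -> cauchy F -> cvg F.
Proof.
move=> FF /cauchy_ballP Fc.
have Gc : cauchy (sub_val @ F).
  apply/cauchy_ballP => e e0.
  have [[A B] /= [FA FB] AB] := Fc e e0.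
  exists (sub_val @` A, sub_val @` B) => /=.
    by split; [move: FA|move: FB]; apply: filterS => x Ax; exists x.
  by move=> [_ _] /= [[x Ax <-] [y By <-]]; rewrite -ball_normE; exact: (AB (x, y)).
have [l Gl] := (cvg_ex _).1 (cauchy_cvg (sub_val @ F) Gc).
have Sl : sub_set S l.
  apply: (@sub_closed _ _ S) => A /Gl; rewrite nbhs_filterE => GA.
  have [x] := @filter_ex _ F _ _ GA.
  by exists (sub_val x); split=> //; apply/asboolP; exact: (sub_valP x).
have ml : sub_cstar_mem l by apply/asboolP.
apply/cvg_ex; exists (SubElt ml); apply/cvgrPdist_lt => e e0.
by move/cvgrPdist_lt : Gl => /(_ e e0).
Qed.

HB.instance Definition _ := Uniform_isComplete.Build sub_cstar_type sub_complete.

Lemma sub_tp_subproof (x y z : sub_cstar_type) : sub_cstar_mem (tp (sub_val x) (sub_val y) (sub_val z)).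
Proof.
by apply/asboolP; apply: sub_tp; apply/asboolP; exact: sub_valP.
Qed.

Definition stp (x y z : sub_cstar_type) : sub_cstar_type := SubElt (sub_tp_subproof x y z).

Let stp_linearl y z : linear (fun x => stp x y z).
Proof. by move=> a x x'; apply: val_inj; rewrite /= tp_linearl. Qed.
Let stp_conjlinear x z (a : C) y y' :
  stp x (a *: y + y') z = a^* *: stp x y z + stp x y' z.
Proof. by apply: val_inj; rewrite /= tp_conjlinear. Qed.
Let stp_linearr x y : linear (stp x y).
Proof. by move=> a z z'; apply: val_inj; rewrite /= tp_linearr. Qed.
Let stp_assocm x y z u v : stp (stp x y z) u v = stp x (stp u z y) v.
Proof. by apply: val_inj; rewrite /= tp_assocm. Qed.
Let stp_assocr x y z u v : stp (stp x y z) u v = stp x y (stp z u v).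
Proof. by apply: val_inj; rewrite /= tp_assocr. Qed.
HB.instance Definition _ := isAssocTriple.Build C sub_cstar_type
  stp_linearl stp_conjlinear stp_linearr stp_assocm stp_assocr.

Let norm_stp_le x y z : `|stp x y z| <= `|x| * `|y| * `|z|.
Proof. exact: norm_tp_le. Qed.
Let norm_stp_cube x : `|stp x x x| = `|x| ^+ 3.
Proof. exact: norm_tp_cube. Qed.
HB.instance Definition _ := AssocTriple_isCstarTernary.Build C sub_cstar_type
  norm_stp_le norm_stp_cube.
End sub_cstar_ring.

Lemma normed_closureP (C : numFieldType) (V : normedModType C) (S : set V) (x : V) :
  closure S x <-> forall e, 0 < e -> exists2 s, S s & `|x - s| < e.
Proof.
split=> [Sx e e0|Sx A /nbhs_normP[e /= e0 eA]].
  by have [s [Ss]] := Sx _ (nbhsx_ballx x e e0); rewrite -ball_normE; exists s.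
by have [s Ss xs] := Sx e e0; exists s; split=> //; exact: eA.
Qed.

Lemma closure_stable (T U : topologicalType) (f : T -> U) (S : set T) (S' : set U) :
  continuous f -> (forall x, S x -> closure S' (f x)) ->
  forall x, closure S x -> closure S' (f x).
Proof.
move=> cf fS x Sx; rewrite (closure_id (closure S')).1; last exact: closed_closure.
by move=> B /cf fB; have [y [/fS ? ?]] := Sx _ fB; exists (f y).
Qed.

Lemma additive_bounded_continuous (C : numFieldType) (V W : normedModType C)
    (f : V -> W) (c : C) :
  {morph f : x y / x + y} -> 0 <= c -> (forall x, `|f x| <= c * `|x|) -> continuous f.
Proof.
move=> fD c0 cf x; have fB y : f x - f y = f (x - y).
  by apply/eqP; rewrite subr_eq -fD subrK.
have c1 : 0 < c + 1 by rewrite ltr_wpDl.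
apply/(@cvgrPdist_lt _ _ _ (nbhs x)) => e e0; apply/nbhs_normP.
exists (e / (c + 1)); first by rewrite /= divr_gt0.
move=> y /=; rewrite ltr_pdivlMr// mulrC => h; apply: le_lt_trans h.
by rewrite fB (le_trans (cf _))// ler_wpM2r// lerDl.
Qed.

Section zmod_closure.
Variables (C : numFieldType) (V : normedModType C) (S : set V).
Hypotheses (S0 : S 0) (SB : forall x y, S x -> S y -> S (x - y)).
Lemma zmod_closed_closure : zmod_closed (fun x => `[< closure S x >]).
Proof.
split=> [|x y /asboolP /normed_closureP Sx /asboolP /normed_closureP Sy].
  by apply/asboolP; exact: subset_closure.
apply/asboolP/normed_closureP => e e0.
have e2 : 0 < e / 2 by rewrite divr_gt0.
have [s Ss xs] := Sx _ e2; have [t St yt] := Sy _ e2.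
exists (s - t); first exact: SB.
rewrite opprD addrACA -opprD (le_lt_trans (ler_normB _ _))//.
by rewrite [e](splitr e) ltrD.
Qed.
End zmod_closure.

Section normed_standard_embedding.
Variables (R : realType) (M : cstarTernaryType R[i]).

Local Notation BM := (bop M M).

Lemma bounded_op_tpl (g h : M) : bounded_op (tp g h).
Proof.
by apply/asboolP; split; [exact: tp_linearr | exists (`|g| * `|h|); exact: norm_tp_le].
Qed.

Lemma bounded_op_tpr (g h : M) : bounded_op (fun x : M => tp x g h).
Proof.
apply/asboolP; split; first exact: tp_linearl.
by exists (`|g| * `|h|) => x; rewrite (le_trans (norm_tp_le _ _ _))// -mulrA mulrC.
Qed.

(* Pairs of operators. The vector space structure that [BM * BM] inherits as a
   product is used for the sum, the norm and the topology only: the scalars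
   acting on pairs are those of [pscale]. *)
Definition ell (g h : M) : BM * BM := (Bop (bounded_op_tpl g h), Bop (bounded_op_tpl h g)).
Definition rho (g h : M) : BM * BM := (Bop (bounded_op_tpr g h), Bop (bounded_op_tpr h g)).

Definition pscale (c : R[i]) (A : BM * BM) : BM * BM := (c *: A.1, c^* *: A.2).

(* The products of [L(M)] and [R(M)]. *)
Definition lmul (A A' : BM * BM) : BM * BM := (bcomp A.1 A'.1, bcomp A'.2 A.2).
Definition rmul (B B' : BM * BM) : BM * BM := (bcomp B'.1 B.1, bcomp B.2 B'.2).

Definition pspan (e : M -> M -> BM * BM) : set (BM * BM) :=
  [set A | exists n (c : 'I_n -> R[i]) (g h : 'I_n -> M),
     A = \sum_(i < n) pscale (c i) (e (g i) (h i))].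

Lemma pair_norm_le (V W : normedModType R[i]) (x : V) (y : W) (c : R[i]) :
  (`|(x, y)| <= c) = (`|x| <= c) && (`|y| <= c).
Proof. by rewrite prod_normE comparable_ge_max// real_comparable ?normr_real. Qed.

Lemma pair_norm_lt (V W : normedModType R[i]) (x : V) (y : W) (c : R[i]) :
  (`|(x, y)| < c) = (`|x| < c) && (`|y| < c).
Proof. by rewrite prod_normE comparable_gt_max// real_comparable ?normr_real. Qed.

Lemma pair_norms (V W : normedModType R[i]) (x : V * W) :
  (`|x.1| <= `|x|) && (`|x.2| <= `|x|).
Proof. by rewrite -pair_norm_le -surjective_pairing. Qed.

Lemma bdiag_le (A : BM * BM) (z : M * M) : `|(A.1 z.1, A.2 z.2)| <= `|A| * `|z|.
Proof.
have /andP[A1 A2] := pair_norms A; have /andP[z1 z2] := pair_norms z.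
rewrite pair_norm_le; apply/andP; split.
  by rewrite (le_trans (opnormP _ _))// ler_pM ?opnorm_ge0.
by rewrite (le_trans (opnormP _ _))// ler_pM ?opnorm_ge0.
Qed.

Lemma bounded_op_diag (A : BM * BM) :
  bounded_op (fun z : M * M => (A.1 z.1, A.2 z.2)).
Proof.
apply/asboolP; split=> [a x y|]; first by rewrite /= !linearP.
by exists `|A|; exact: bdiag_le.
Qed.

Definition bdiag (A : BM * BM) : bop (M * M)%type (M * M)%type :=
  Bop (bounded_op_diag A).

(* The closure in [B(M (+) M)], [M (+) M] carrying the max norm and pairs
   acting diagonally. *)
Definition pclosure (S : set (BM * BM)) : set (BM * BM) :=
  [set A | closure (bdiag @` S) (bdiag A)].

Lemma bdiagB A B : bdiag (A - B) = bdiag A - bdiag B.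
Proof. exact: bop_eqP. Qed.

Lemma norm_bdiag A : `|bdiag A| = `|A|.
Proof.
apply/eqP; rewrite eq_le; apply/andP; split.
  by apply: opnorm_le => //; exact: bdiag_le.
rewrite {1}(surjective_pairing A) pair_norm_le; apply/andP; split.
  apply: opnorm_le => // x.
  have := opnormP (bdiag A) (x, 0); rewrite /= pair_norm_le => /andP[h _].
  by rewrite (le_trans h)// ler_wpM2l ?opnorm_ge0// pair_norm_le lexx normr0 normr_ge0.
apply: opnorm_le => // x.
have := opnormP (bdiag A) (0, x); rewrite /= pair_norm_le => /andP[_ h].
by rewrite (le_trans h)// ler_wpM2l ?opnorm_ge0// pair_norm_le lexx normr0 normr_ge0.
Qed.

Lemma pclosureE S : pclosure S = closure S.
Proof.
apply/seteqP; split=> A.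
  move=> /normed_closureP SA; apply/normed_closureP => e /SA[_ [B SB <-]] AB.
  by exists B => //; rewrite -norm_bdiag bdiagB.
move=> /normed_closureP SA; apply/normed_closureP => e /SA[B SB AB].
by exists (bdiag B); [exists B|rewrite -bdiagB norm_bdiag].
Qed.

Lemma pscaleA c d A : pscale c (pscale d A) = pscale (c * d) A.
Proof. by rewrite /pscale /= !scalerA rmorphM. Qed.

Lemma pspan0 e : pspan e 0.
Proof.
by exists 0%N, (fun _ => 0), (fun _ => 0), (fun _ => 0); rewrite big_ord0.
Qed.

Lemma pspan_gen e g h : pspan e (e g h).
Proof.
exists 1%N, (fun _ => 1), (fun _ => g), (fun _ => h).
by rewrite big_ord1 /pscale conjC1 !scale1r -surjective_pairing.
Qed.

Lemma pspanN e A : pspan e A -> pspan e (- A).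
Proof.
move=> [n [c [g [h ->]]]]; exists n, (fun i => - c i), g, h.
rewrite -sumrN; apply: eq_bigr => i _.
by rewrite /pscale rmorphN !scaleNr.
Qed.

Lemma pspanD e A B : pspan e A -> pspan e B -> pspan e (A + B).
Proof.
move=> [n [c [g [h ->]]]] [n' [c' [g' [h' ->]]]].
pose u T (f : 'I_n -> T) (f' : 'I_n' -> T) (i : 'I_(n + n')) :=
  match fintype.split i with inl j => f j | inr j => f' j end.
exists (n + n')%N, (u _ c c'), (u _ g g'), (u _ h h').
rewrite big_split_ord /=; congr (_ + _); apply: eq_bigr => i _; rewrite /u.
  by rewrite (unsplitK (inl i : 'I_n + 'I_n')).
by rewrite (unsplitK (inr i : 'I_n + 'I_n')).
Qed.

Lemma pspan_ind e (P : set (BM * BM)) :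
  P 0 -> (forall A B, P A -> P B -> P (A + B)) ->
  (forall c g h, P (pscale c (e g h))) -> pspan e `<=` P.
Proof.
by move=> P0 PD Pe _ [n [c [g [h ->]]]]; elim/big_ind : _.
Qed.

Definition Lset : set (BM * BM) := pclosure (pspan ell).
Definition Rset : set (BM * BM) := pclosure (pspan rho).

Lemma ell_Lset g h : Lset (ell g h).
Proof. by rewrite /Lset pclosureE; apply: subset_closure; exact: pspan_gen. Qed.

Lemma rho_Rset g h : Rset (rho g h).
Proof. by rewrite /Rset pclosureE; apply: subset_closure; exact: pspan_gen. Qed.

Lemma pclosure_zmod e : zmod_closed (fun A => `[< pclosure (pspan e) A >]).
Proof.
rewrite pclosureE; apply: zmod_closed_closure; first exact: pspan0.
by move=> A B SA SB; apply: pspanD => //; exact: pspanN.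
Qed.

Lemma tpZl c x y z : tp (c *: x) y z = c *: (tp x y z : M).
Proof. exact: (linearZ_LR (Bop (bounded_op_tpr y z))). Qed.

Lemma tpZr c x y z : tp x y (c *: z) = c *: (tp x y z : M).
Proof. exact: (linearZ_LR (Bop (bounded_op_tpl x y))). Qed.

Lemma tp0m x z : tp x (0 : M) z = 0.
Proof.
have /eqP := tp_conjlinear x z 1 0 0.
by rewrite scaler0 addr0 conjC1 scale1r -subr_eq0 opprD addrA subrr sub0r oppr_eq0 => /eqP.
Qed.

Lemma tpZm c x y z : tp x (c *: y) z = c^* *: (tp x y z : M).
Proof. by have := tp_conjlinear x z c y 0; rewrite tp0m !addr0. Qed.

Lemma pscale_ell c g h : pscale c (ell g h) = ell (c *: g) h.
Proof.
by congr (_, _); apply: bop_eqP => x /=; [rewrite tpZl|rewrite tpZm].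
Qed.

Lemma pscale_rho c g h : pscale c (rho g h) = rho g (c *: h).
Proof.
by congr (_, _); apply: bop_eqP => x /=; [rewrite tpZr|rewrite tpZm].
Qed.

Lemma ell_mul g h u v : lmul (ell g h) (ell u v) = ell (tp g h u) v.
Proof.
congr (_, _); apply: bop_eqP => x /=; first by rewrite -tp_assocr.
by rewrite -tp_assocr tp_assocm.
Qed.

Lemma rho_mul g h u v : rmul (rho g h) (rho u v) = rho g (tp h u v).
Proof.
congr (_, _); apply: bop_eqP => x /=; first by rewrite tp_assocr.
by rewrite tp_assocm.
Qed.

Lemma lmulDl A A' B : lmul (A + A') B = lmul A B + lmul A' B.
Proof. by congr (_, _); rewrite ?bcompDl ?bcompDr. Qed.
Lemma lmulDr A B B' : lmul A (B + B') = lmul A B + lmul A B'.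
Proof. by congr (_, _); rewrite ?bcompDl ?bcompDr. Qed.
Lemma rmulDl A A' B : rmul (A + A') B = rmul A B + rmul A' B.
Proof. by congr (_, _); rewrite ?bcompDl ?bcompDr. Qed.
Lemma rmulDr A B B' : rmul A (B + B') = rmul A B + rmul A B'.
Proof. by congr (_, _); rewrite ?bcompDl ?bcompDr. Qed.

Lemma norm_lmul A B : `|lmul A B| <= `|A| * `|B|.
Proof.
have /andP[A1 A2] := pair_norms A; have /andP[B1 B2] := pair_norms B.
rewrite pair_norm_le; apply/andP; split; apply: le_trans (norm_bcomp _ _) _.
  exact: ler_pM A1 B1.
by rewrite mulrC; exact: ler_pM A2 B2.
Qed.

Lemma norm_rmul A B : `|rmul A B| <= `|A| * `|B|.
Proof.
have /andP[A1 A2] := pair_norms A; have /andP[B1 B2] := pair_norms B.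
rewrite pair_norm_le; apply/andP; split; apply: le_trans (norm_bcomp _ _) _.
  by rewrite mulrC; exact: ler_pM A1 B1.
exact: ler_pM A2 B2.
Qed.

Lemma closure_mul (mul : BM * BM -> BM * BM -> BM * BM) (S : set (BM * BM)) :
  (forall A, {morph mul A : B B' / B + B'}) ->
  (forall B, {morph mul^~ B : A A' / A + A'}) ->
  (forall A B, `|mul A B| <= `|A| * `|B|) ->
  (forall A B, S A -> S B -> S (mul A B)) ->
  forall A B, pclosure S A -> pclosure S B -> pclosure S (mul A B).
Proof.
rewrite pclosureE => mDr mDl mle SM A B SA SB.
have cr A' : continuous (mul A') by exact: additive_bounded_continuous (mle A').
have cl B' : continuous (mul^~ B').
  apply: (@additive_bounded_continuous _ _ _ _ `|B'|) => // A'.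
  by rewrite mulrC; exact: mle.
apply: (closure_stable (cl B)) SA => {}A SA.
apply: (closure_stable (cr A)) SB => {}B SB.
by apply: subset_closure; exact: SM.
Qed.

Lemma pspan_ell_mul A B : pspan ell A -> pspan ell B -> pspan ell (lmul A B).
Proof.
move=> SA; move: B; apply: pspan_ind => [|B B' SB SB'|c u v].
- have := lmulDr A 0 0; rewrite addr0.
  by rewrite -[LHS]addr0 => /addrI <-; exact: pspan0.
- by rewrite lmulDr; exact: pspanD.
rewrite pscale_ell; move: (c *: u) => {c}u; move: A SA; apply: pspan_ind => [|A A' SA SA'|c g h].
- have := lmulDl 0 0 (ell u v); rewrite addr0.
  by rewrite -[LHS]addr0 => /addrI <-; exact: pspan0.
- by rewrite lmulDl; exact: pspanD.
by rewrite pscale_ell ell_mul; exact: pspan_gen.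
Qed.

Lemma pspan_rho_mul A B : pspan rho A -> pspan rho B -> pspan rho (rmul A B).
Proof.
move=> SA; move: B; apply: pspan_ind => [|B B' SB SB'|c u v].
- have := rmulDr A 0 0; rewrite addr0.
  by rewrite -[LHS]addr0 => /addrI <-; exact: pspan0.
- by rewrite rmulDr; exact: pspanD.
rewrite pscale_rho; move: (c *: v) => {c}v; move: A SA; apply: pspan_ind => [|A A' SA SA'|c g h].
- have := rmulDl 0 0 (rho u v); rewrite addr0.
  by rewrite -[LHS]addr0 => /addrI <-; exact: pspan0.
- by rewrite rmulDl; exact: pspanD.
by rewrite pscale_rho rho_mul; exact: pspan_gen.
Qed.

Lemma Lset_mul A A' : Lset A -> Lset A' -> Lset (lmul A A').
Proof.
apply: closure_mul.
- exact: lmulDr.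
- by move=> C D D'; exact: lmulDl.
- exact: norm_lmul.
- exact: pspan_ell_mul. Qed.

Lemma Rset_mul B B' : Rset B -> Rset B' -> Rset (rmul B B').
Proof.
apply: closure_mul.
- exact: rmulDr.
- by move=> C D D'; exact: rmulDl.
- exact: norm_rmul.
- exact: pspan_rho_mul. Qed.

Definition Lmem : pred (BM * BM) := fun A => `[< Lset A >].
Definition Rmem : pred (BM * BM) := fun B => `[< Rset B >].

Record Lalg := LElt { lval :> BM * BM ; lvalP : Lmem lval }.
Record Ralg := RElt { rval :> BM * BM ; rvalP : Rmem rval }.

HB.instance Definition _ := GRing.isZmodClosed.Build _ Lmem (pclosure_zmod ell).
HB.instance Definition _ := GRing.isZmodClosed.Build _ Rmem (pclosure_zmod rho).
HB.instance Definition _ := [isSub for lval].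
HB.instance Definition _ := [Choice of Lalg by <:].
HB.instance Definition _ := [SubChoice_isSubZmodule of Lalg by <:].
HB.instance Definition _ := [isSub for rval].
HB.instance Definition _ := [Choice of Ralg by <:].
HB.instance Definition _ := [SubChoice_isSubZmodule of Ralg by <:].

Lemma Lmem_ell g h : Lmem (ell g h).
Proof. by apply/asboolP; exact: ell_Lset. Qed.
Lemma Rmem_rho g h : Rmem (rho g h).
Proof. by apply/asboolP; exact: rho_Rset. Qed.
Lemma Lmem_mul (A A' : Lalg) : Lmem (lmul A A').
Proof. by apply/asboolP; apply: Lset_mul; apply/asboolP; exact: lvalP. Qed.
Lemma Rmem_mul (B B' : Ralg) : Rmem (rmul B B').
Proof. by apply/asboolP; apply: Rset_mul; apply/asboolP; exact: rvalP. Qed.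

(* [(A, f, g, B)] stands for the matrix with rows [A f] and [gbar B], where
   [gbar] is the element of the conjugate space given by [g]; hence [g] is acted
   upon by the second components of [A] and [B]. Only the ring structure is set
   up, being all that the radical depends on: neither the scalars
   [c . (A, f, g, B) = (pscale c A, c *: f, c^* *: g, pscale c B)], nor the
   involution, nor the norm are. *)
Definition std_embedding := (Lalg * M * M * Ralg)%type.
HB.instance Definition _ := GRing.Zmodule.on std_embedding.

Definition std_embedding_mul (x x' : std_embedding) : std_embedding :=
  let '(A, f, g, B) := x in let '(A', f', g', B') := x' in
  (LElt (Lmem_mul A A') + LElt (Lmem_ell f g'),
   (lval A).1 f' + (rval B').1 f,
   (lval A').2 g + (rval B).2 g',
   RElt (Rmem_rho g f') + RElt (Rmem_mul B B')).

End normed_standard_embedding.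

(* The inner product is linear in its first variable. *)
Record hilbert (R : realType) := Hilbert {
  hilbert_sort :> completeNormedModType R[i] ;
  hdot : {dot hilbert_sort for (@Num.conj R[i] : R[i] -> R[i])} ;
  hilbert_norm : forall x : hilbert_sort, `|x| ^+ 2 = hdot x x
}.
Arguments hdot {R} h.

Section operator_rings.
Variable R : realType.

Section TRO.
Variables H K : hilbert R.

Definition is_adjoint (T : bop H K) (S : bop K H) :=
  forall x y, hdot K (T x) y = hdot H x (S y).

(* By the Riesz representation theorem there is exactly one adjoint, so that the
   default value [0] of [xget] is never used. *)
Definition adjoint (T : bop H K) : bop K H := xget 0 (is_adjoint T).

Definition op_triple (x y z : bop H K) : bop H K :=
  bcomp x (bcomp (adjoint y) z).

Definition is_TRO (V : set (bop H K)) :=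
  [/\ linear_subset V, closed V &
      forall x y z, V x -> V y -> V z -> V (op_triple x y z)].

End TRO.

(* [M], as a C*-ternary ring, is (up to isometric isomorphism of triple systems)
   a TRO, resp. an anti-TRO. *)
Definition TRO_ternary (M : cstarTernaryType R[i]) :=
  exists (H K : hilbert R) (V : set (bop H K)) (phi : {linear M -> bop H K}),
    [/\ is_TRO V, range phi = V, forall x, `|phi x| = `|x| &
        forall x y z, phi (tp x y z) = op_triple (phi x) (phi y) (phi z)].

Definition anti_TRO_ternary (M : cstarTernaryType R[i]) :=
  exists (H K : hilbert R) (V : set (bop H K)) (phi : {linear M -> bop H K}),
    [/\ is_TRO V, range phi = V, forall x, `|phi x| = `|x| &
        forall x y z, phi (tp x y z) = - op_triple (phi x) (phi y) (phi z)].

Definition cstar_direct_sum (M : cstarTernaryType R[i]) (S T : sub_cstar M) :=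
  [/\ forall x, exists y z, [/\ sub_set S y, sub_set T z & x = y + z],
      sub_set S `&` sub_set T = [set 0] &
      forall x y z x' y' z', sub_set S x -> sub_set S y -> sub_set S z ->
        sub_set T x' -> sub_set T y' -> sub_set T z' ->
        tp (x + x') (y + y') (z + z') = tp x y z + tp x' y' z'].

Definition zettl_decomposition (M : cstarTernaryType R[i]) (Mp Mm : sub_cstar M) :=
  [/\ cstar_direct_sum Mp Mm, TRO_ternary (sub_cstar_type Mp) &
      anti_TRO_ternary (sub_cstar_type Mm)].

End operator_rings.

Definition triple_radical (C : numClosedFieldType) (M : assocTripleType C) : set M :=
  [set x | forall u, exists y, y - x = tp y u x /\ y - x = tp x u y].

Definition triple_semisimple (C : numClosedFieldType) (M : assocTripleType C) :=
  @triple_radical C M = [set 0].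

Definition jacobson_radical (A : zmodType) (mul : A -> A -> A) : set A :=
  [set x | forall u, exists y,
     y - x = mul (mul x u) y /\ y - x = mul (mul y u) x].

Definition algebra_semisimple (A : zmodType) (mul : A -> A -> A) :=
  jacobson_radical mul = [set 0].

(* Main.v *)
(* Let x be in the radical of a C*-ternary ring, |x| = 1, and T z = [xxz]. Taking
   u to be a multiple of x, one gets for each complex m a solution y_m of
   y = x + m T y = x + m [yxx], and y_m is bounded for |m| <= 1 by compactness.
   Following Rickart's elementary proof of the spectral radius formula, averaging
   over the square roots of m passes from T to T^2, then to T^4, and so on, without
   losing uniformity in m: for N = 2^k large, y = x + T^N y has a solution close to
   that of y' = x + r^N T^N y' with r < 1, hence close to x, so that T^N x is
   small. But [zzz] = T^(3n+1) x for z = T^n x, so |[zzz]| = |z|^3 gives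
   |T^n x| = 1 for all n. The radical is thus 0, for TROs and anti-TROs alike.

   If (A, f, g, B) is in the radical of the standard embedding, test elements with a
   single nonzero entry show that f, g and the values of A and B are in the radical
   of the triple system, hence are 0. *)
Require Import Defs.
From mathcomp Require Import all_boot all_order all_algebra.
From mathcomp Require Import complex.
From mathcomp Require Import all_classical all_reals all_analysis.
From mathcomp Require Import ring lra.

Import Order.TTheory GRing.Theory Num.Theory numFieldNormedType.Exports.

Local Open Scope complex_scope.
Local Open Scope classical_set_scope.
Local Open Scope ring_scope.

(** * Compactness of the disk, powers of [xx.], averaging over square roots *)

(** The disk lies in the compact square [K], which finitely many of the given neighbourhoods
    cover. *)
Lemma locally_bounded_unit_disk {R : realType} (f : R[i] -> R[i]) :
  (forall a, exists c e : R, 0 < e /\ forall b, `|b - a| < e%:C -> f b <= c%:C) ->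
  exists c : R, forall a, `|a| <= 1 -> f a <= c%:C.
Proof.
move=> fbd; pose K := `[(-1 : R), 1]%classic `*` `[(-1 : R), 1]%classic.
have /compact_near_coveringP cK : compact K.
  by apply: compact_setX; exact: segment_compact.
have : \forall c \near +oo%R, K `<=` (fun p => f (p.1 +i* p.2) <= c%:C).
  apply: cK => -[a b] _; have [c [e [e0 fc]]] := fbd (a +i* b).
  (* Balls of the product are squares: two coordinates within e/2 give a modulus below e. *)
  exists (ball (a, b) (e / 2), [set c' | c <= c']).
    split; last by apply: nbhs_pinfty_ge; exact: num_real.
    by apply: nbhsx_ballx; rewrite divr_gt0.
  move=> [[a' b'] c'] [/= [/= aa' bb'] cc'].
  apply: (@le_trans _ _ c%:C); last by rewrite lecR.
  apply: fc.
  have -> : (a' +i* b') - (a +i* b) = (a' - a)%:C + 'i * (b' - b)%:C.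
    by apply/eqP; rewrite eq_complex /=; apply/andP; split; apply/eqP; ring.
  rewrite (le_lt_trans (ler_normD _ _))// normrM.
  have -> : `|'i : R[i]| = 1 by exact: normCi.
  rewrite mul1r.
  have nC (r : R) : `|r%:C| = `|r|%:C.
    by rewrite normc_def /= expr0n addr0 sqrtr_sqr.
  by rewrite !nC -rmorphD /= ltcR [ltRHS]splitr ltrD // distrC.
move=> /filter_ex[c Kc]; exists c => -[a b] ab1.
have := Kc (a, b); apply; split => /=; rewrite in_itv /= -ler_norml -lecR.
  exact: le_trans (normc_ge_Re _) ab1.
(* Multiplication by i turns the imaginary part, up to sign, into a real part. *)
have := normc_ge_Re ('i * (a +i* b)); rewrite normrM normCi mul1r => h.
apply: le_trans ab1; apply: le_trans h.
by rewrite lecR /= !mul0r mul1r sub0r normrN.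
Qed.

(** A factor T leaves the left slot by [tp_assocr]; [tp_assocm] carries one from the middle slot to
    z. The successor counts the remaining [xxz] = T z. *)
Lemma tp_iter {C : numClosedFieldType} {M : assocTripleType C} (x z : M) (a b : nat) :
  let T := tp x x in
  tp (iter a T x) (iter b T x) z = iter (a + b).+1 T z.
Proof.
move=> T; elim: a => [|a IH] /=; last by rewrite tp_assocr IH.
elim: b z => [//|b IH] z /=.
by rewrite -[LHS]tp_assocm tp_assocr IH -iterSr.
Qed.

(** T is a contraction, which bounds the norm above. Below, if z = T^n x has norm 1, so has [zzz] =
    T^(2n) (T^(n+1) x), and T^(n+1) x cannot be shorter. *)
Lemma norm_tp_iter {R : realType} {M : cstarTernaryType R[i]} (x : M) (n : nat) :
  `|x| = 1 -> `|iter n (tp x x) x| = 1.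
Proof.
move=> x1; set T := tp x x.
have Tle z : `|T z| <= `|z|.
  by rewrite (le_trans (norm_tp_le _ _ _))// x1 !mul1r.
have iterle m z : `|iter m T z| <= `|z|.
  by elim: m => //= m IH; exact: le_trans (Tle _) IH.
elim: n => // n IH; apply/eqP; rewrite eq_le -{1}x1 iterle /=.
have : `|tp (iter n T x) (iter n T x) (iter n T x)| = 1 by rewrite norm_tp_cube IH expr1n.
by rewrite tp_iter -iterD addSn -addnS iterD => <-; exact: iterle.
Qed.

Lemma triple_radicalZ {R : realType} {M : cstarTernaryType R[i]} (c : R[i]) (x : M) :
  triple_radical x -> triple_radical (c *: x).
Proof.
(* The middle slot is conjugate-linear, so this test element produces the factor c. *)
move=> xr u; have [y [yl yr]] := xr (c^* *: u)%R.
exists (c *: y); rewrite -scalerBr; split.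
  by rewrite yl tpZm conjCK tpZl tpZr.
by rewrite yr tpZm conjCK tpZl tpZr.
Qed.

(** The odd part in s cancels, formally: (1 - sA)^-1 + (1 + sA)^-1 = 2 (1 - s^2 A^2)^-1. *)
Lemma half_sum_fixpoint {C : numFieldType} {V : lmodType C} (A : {linear V -> V})
    (s : C) (x y1 y2 : V) :
  y1 = x + s *: A y1 -> y2 = x + (- s) *: A y2 ->
  2^-1 *: (y1 + y2) = x + s ^+ 2 *: A (A (2^-1 *: (y1 + y2))).
Proof.
move=> e1 e2.
have h1 : A y1 = A x + s *: A (A y1) by rewrite {1}e1 linearD linearZ.
have h2 : A y2 = A x - s *: A (A y2) by rewrite {1}e2 linearD linearZ /= scaleNr.
have two (v : V) : 2^-1 *: (v + v) = v.
  by rewrite -mulr2n -(scaler_nat 2 v) scalerA mulVf ?scale1r ?pnatr_eq0.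
transitivity (x + 2^-1 *: (s *: (A y1 - A y2))).
  rewrite {1}e1 {1}e2 addrACA scalerDr two; congr (_ + _ *: _).
  by rewrite scaleNr scalerBr.
have h3 : A (A (2^-1 *: (y1 + y2))) = 2^-1 *: (A (A y1) + A (A y2)).
  by rewrite linearZ /= linearZ /= linearD linearD.
rewrite h1 h2 h3 opprD opprK addrACA subrr add0r -scalerDr !scalerA.
by rewrite [_ * 2^-1]mulrC expr2 mulrA.
Qed.

(** * Resolvents of [xx.] and their uniform bounds *)

Lemma tp0l {R : realType} {M : cstarTernaryType R[i]} (y z : M) : tp (0 : M) y z = 0.
Proof. exact: (linear0 (Bop (bounded_op_tpr y z))). Qed.

Lemma tpr0 {R : realType} {M : cstarTernaryType R[i]} (x y : M) : tp x y (0 : M) = 0.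
Proof. exact: (linear0 (Bop (bounded_op_tpl x y))). Qed.

Lemma tpDl {R : realType} {M : cstarTernaryType R[i]} (x x' y z : M) :
  tp (x + x') y z = tp x y z + tp x' y z.
Proof. exact: (linearD (Bop (bounded_op_tpr y z))). Qed.

Lemma tpDr {R : realType} {M : cstarTernaryType R[i]} (x y z z' : M) :
  tp x y (z + z') = tp x y z + tp x y z'.
Proof. exact: (linearD (Bop (bounded_op_tpl x y))). Qed.

(* The inverse of 1 - m [xx.] is 1 + m [yx.]. *)
Lemma resolvent_le {R : realType} {M : cstarTernaryType R[i]} {x y y' : M} {m m' : R[i]} :
  `|x| = 1 -> y = x + m *: tp x x y -> y = x + m *: tp y x x -> y' = x + m' *: tp x x y' ->
  `|y - y'| <= `|m - m'| * (1 + `|m| * `|y|) * `|y'|.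
Proof.
move=> x1 yl yr y'l; pose w := (m - m') *: tp x x y'.
have tpBr u v a b : tp a b (u - v : M) = tp a b u - tp a b v.
  exact: (linearB (Bop (bounded_op_tpl a b))).
have yy' : (y - y') - m *: tp x x (y - y') = w.
  have dE : y - y' = m *: tp x x y - m' *: tp x x y'.
    by rewrite {1}yl {1}y'l opprD addrACA subrr add0r.
  by rewrite tpBr scalerBr dE opprB addrC subrKA /w scalerBl.
have -> : y - y' = w + m *: tp y x w.
  rewrite -yy'; move: (y - y') => z.
  rewrite tpBr tpZr -tp_assocr.
  have -> : tp y x z = tp x x z + m *: tp (tp y x x) x z by rewrite {1}yr tpDl tpZl.
  by rewrite scalerBr scalerDr addrK subrK.
have wle : `|w| <= `|m - m'| * `|y'|.
  by rewrite normrZ ler_wpM2l// (le_trans (norm_tp_le _ _ _))// x1 !mul1r.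
clearbody w; rewrite (le_trans (ler_normD _ _))// normrZ.
have -> : `|m - m'| * (1 + `|m| * `|y|) * `|y'| =
    `|m - m'| * `|y'| + `|m| * (`|y| * (`|m - m'| * `|y'|)) by ring.
by rewrite lerD// ler_wpM2l// (le_trans (norm_tp_le _ _ _))// x1 mulr1 ler_wpM2l.
Qed.

(** By [resolvent_le], |y a - y b| is at most |y b| / 2 for b near a, so that |y b| <= 2 |y a|
    there; compactness makes the bound uniform. *)
Lemma resolvent_bounded {R : realType} {M : cstarTernaryType R[i]} (x : M)
    (y : R[i] -> M) : `|x| = 1 ->
  (forall m, y m = x + m *: tp x x (y m)) -> (forall m, y m = x + m *: tp (y m) x x) ->
  exists c : R, forall m, `|m| <= 1 -> `|y m| <= c%:C.
Proof.
move=> x1 yl yr; apply: (locally_bounded_unit_disk (fun m => `|y m|)) => a.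
pose k := complex.Re (1 + `|a| * `|y a|).
have kE : k%:C = 1 + `|a| * `|y a|.
  by rewrite RRe_real// ger0_real// addr_ge0// mulr_ge0.
have k0 : 0 < k by rewrite -ltcR kE ltr_pwDl ?mulr_ge0.
exists (2 * complex.Re `|y a|), ((2 * k)^-1); split; first by rewrite invr_gt0 mulr_gt0.
move=> b ba; have := resolvent_le x1 (yl a) (yr a) (yl b).
rewrite -kE => h.
have {}h : `|y a - y b| <= 2^-1 * `|y b|.
  apply: (le_trans h); rewrite ler_wpM2r// distrC.
  have -> : 2^-1 = ((2 * k)^-1)%:C * k%:C :> R[i].
    by rewrite -rmorphM /= invfM -mulrA mulVf ?gt_eqF// mulr1 fmorphV rmorph_nat.
  by rewrite ler_wpM2r ?ltW // ltcR.
have := ler_normB (y a) (y a - y b); rewrite opprB addrC subrK => h2.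
rewrite rmorphM rmorph_nat /= norm_ReE.
have := le_trans h2 (lerD (lexx _) h).
rewrite -lerBlDr -{1}[`|y b|]mul1r -mulrBl.
have -> : 1 - 2^-1 = 2^-1 :> R[i] by field.
by rewrite ler_pdivrMl.
Qed.

(** Here [A k] is T^(2^k). Solutions for [A k.+1] at m are means of those for [A k] at the two
    square roots of m, again in the disk. Means preserve the bounds d and c, so these do not depend
    on k. *)
Lemma averaged_resolvents {R : realType} {V : normedModType R[i]} (T : bop V V)
    (x : V) (r d c : R[i]) :
  let A k := iter k (fun S => bcomp S S) T in
  (forall m, `|m| <= 1 -> exists y y', [/\ y = x + m *: T y,
     y' = x + (r * m) *: T y', `|y - y'| <= d & `|y'| <= c]) ->
  forall k m, `|m| <= 1 -> exists y y', [/\ y = x + m *: A k y,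
     y' = x + (r ^+ (2 ^ k) * m) *: A k y', `|y - y'| <= d & `|y'| <= c].
Proof.
move=> A h0; elim=> [//|k IH] m m1.
have half (u v : V) e : `|u| <= e -> `|v| <= e -> `|2^-1 *: (u + v)| <= e.
  move=> ue ve; rewrite normrZ ger0_norm ?invr_ge0// ler_pdivrMl// mulrC mulr_natr mulr2n.
  by rewrite (le_trans (ler_normD _ _))// lerD.
have s1 : `|sqrtC m| <= 1 by rewrite -(@ler_pXn2r _ 2)// ?nnegrE// -normrX sqrtCK expr1n.
have [y1 [y1' [e1 e1' d1 c1]]] := IH _ s1.
have [|y2 [y2' [e2 e2' d2 c2]]] := IH (- sqrtC m); first by rewrite normrN.
exists (2^-1 *: (y1 + y2)), (2^-1 *: (y1' + y2')); split.
- by rewrite [LHS](half_sum_fixpoint (A k) (sqrtC m) x) // sqrtCK.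
- rewrite mulrN in e2'.
  rewrite [LHS](half_sum_fixpoint (A k) (r ^+ (2 ^ k) * sqrtC m) x) //.
  by rewrite exprMn sqrtCK -exprM expnSr.
- by rewrite -scalerBr opprD addrACA half.
- exact: half.
Qed.

(** * Semisimplicity of C*-ternary rings *)

Lemma norm1_notin_triple_radical {R : realType} {M : cstarTernaryType R[i]} (x : M) :
  `|x| = 1 -> ~ triple_radical x.
Proof.
move=> x1 xr.
have /choice[y yP] : forall m : R[i], exists y, y = x + m *: tp x x y /\ y = x + m *: tp y x x.
  move=> m; have [y [yl yr]] := xr (m^* *: x)%R; exists y.
  rewrite tpZm conjCK in yl; rewrite tpZm conjCK in yr.
  by split; [rewrite -yr|rewrite -yl]; rewrite addrC subrK.
have yl m := (yP m).1; have yr m := (yP m).2.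
have [c cP] := resolvent_bounded x y x1 yl yr.
have c0 : 0 <= c.
  by rewrite -lecR (le_trans (normr_ge0 (y 0)))// cP ?normr0.
(* On the disk [resolvent_le] bounds |y m - y (r m)| by e (1 + c) c; this e makes that at most 1/8
   and puts r in [0, 1[. *)
pose e : R := (8 * (1 + c) ^+ 2)^-1; pose r := 1 - e.
have e0 : 0 < e by rewrite invr_gt0 mulr_gt0// exprn_gt0// ltr_pwDl.
have e1 : e * ((1 + c) * c) <= 8^-1.
  rewrite /e invfM -mulrA ler_piMr// ler_pdivrMl ?exprn_gt0 ?ltr_pwDl//.
  by rewrite mulr1 expr2 ler_wpM2l ?addr_ge0// lerDr.
have e8 : e <= 8^-1.
  rewrite /e invfM ler_piMr// invf_le1 ?exprn_gt0 ?ltr_pwDl//.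
  by rewrite exprn_ege1// lerDl.
have r0 : 0 <= r by rewrite /r; lra.
have r1 : r < 1 by rewrite /r; lra.
(* It is r^(2^n) that must be small, and it is at most r^n. The threshold uses 1 + c because c is
   only known to be nonnegative. *)
have [n rn] : exists n, r ^+ n * c <= 8^-1.
  have nr1 : `|r| < 1 by rewrite ger0_norm.
  have a0 : 0 < (8 * (1 + c))^-1 by rewrite invr_gt0 mulr_gt0// ltr_pwDl.
  have /cvgr0Pnorm_le rcv := cvg_expr nr1.
  have [n rn] := filter_ex (rcv _ a0).
  exists n; rewrite (le_trans (ler_wpM2r c0 (le_trans (ler_norm _) rn)))//.
  by rewrite invfM -mulrA ler_piMr// ler_pdivrMl ?ltr_pwDl// mulr1 lerDr.
pose T := Bop (bounded_op_tpl x x); pose A k := iter k (fun S => bcomp S S) T.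
have AE k z : A k z = iter (2 ^ k) T z.
  by elim: k z => [//|k IH] z; rewrite expnS mul2n -addnn iterD -!IH.
have Ale k z : `|A k z| <= `|z|.
  rewrite AE; elim: (2 ^ k)%N => //= j IH; apply: le_trans IH.
  by rewrite (le_trans (norm_tp_le _ _ _))// x1 !mul1r.
have rC1 : r%:C <= 1%:C by rewrite lecR ltW.
have rC0 : 0%:C <= r%:C by rewrite lecR.
have [||z [z' [zE z'E zz' z'c]]] :=
    @averaged_resolvents _ _ T x r%:C 8^-1 c%:C _ n 1.
- move=> m m1; exists (y m), (y (r%:C * m)).
  have rm1 : `|r%:C * m| <= 1.
    by rewrite normrM (ger0_norm rC0) mulr_ile1.
  split; [exact: yl|exact: yl| |exact: cP].
  rewrite (le_trans (resolvent_le x1 (yl _) (yr _) (yl _)))//.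
  have -> : m - r%:C * m = e%:C * m by rewrite /r rmorphB rmorph1; ring.
  have eC0 : 0%:C <= e%:C by rewrite lecR ltW.
  have mle : `|m| * (1 + `|m| * `|y m|) <= 1 + c%:C.
    rewrite -[leRHS]mul1r ler_pM ?addr_ge0 ?mulr_ge0// lerD//.
    by rewrite -[leRHS]mul1r ler_pM ?cP.
  apply: (@le_trans _ _ (e%:C * ((1 + c%:C) * c%:C))).
    rewrite normrM (ger0_norm eC0) -!mulrA ler_wpM2l// mulrA.
    by rewrite ler_pM ?mulr_ge0 ?addr_ge0 ?mulr_ge0 ?cP.
  have -> : 8^-1 = (8^-1)%:C :> R[i] by rewrite fmorphV rmorph_nat.
  by rewrite -[1 + _]rmorphD -!rmorphM lecR.
- by rewrite normr1.
rewrite mulr1 in z'E; rewrite scale1r in zE.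
have z'x : `|z' - x| <= 8^-1.
  rewrite z'E addrAC subrr add0r normrZ normrX ger0_norm ?lecR//.
  apply: (@le_trans _ _ (r ^+ n * c)%:C); last first.
    by rewrite -(rmorph_nat (@real_complex R)) -fmorphV lecR.
  rewrite rmorphM rmorphXn; apply: ler_pM => //; first exact: exprn_ge0.
    by rewrite ler_wiXn2l// ltnW// ltn_expl.
  exact: le_trans (Ale _ _) z'c.
have zx : `|z - x| <= 8^-1 + 8^-1.
  by rewrite -(subrKA z') (le_trans (ler_normD _ _))// lerD.
have AzE : A n z = z - x by rewrite {2}zE addrAC subrr add0r.
(* Both z - x and its image under the contraction [A n] have norm at most 1/4, so |A n x| <= 1/2,
   against [norm_tp_iter]. *)
have AxE : A n x = (z - x) - A n (z - x).
  have -> : A n (z - x) = A n z - A n x by exact: linearB.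
  by rewrite AzE opprB addrC subrK.
have : 1 <= `|A n x| by rewrite AE norm_tp_iter.
have : `|A n x| <= (8^-1 + 8^-1) + (8^-1 + 8^-1).
  by rewrite AxE (le_trans (ler_normB _ _))// lerD// (le_trans (Ale _ _)).
move=> /[swap] /le_trans/[apply]; rewrite lt_geF//.
have -> : 8^-1 + 8^-1 + (8^-1 + 8^-1) = 2^-1 :> R[i] by field.
by rewrite invf_lt1// ltr1n.
Qed.

Lemma triple_semisimple_cstar {R : realType} (M : cstarTernaryType R[i]) : triple_semisimple M.
Proof.
apply/seteqP; split=> x /=; last first.
  by move=> -> u; exists 0; rewrite subrr tpr0.
move=> xr; apply/eqP; apply: contraPT (triple_radicalZ `|x|^-1 x xr) => x0.
apply: norm1_notin_triple_radical; rewrite normrZ ger0_norm ?invr_ge0//.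
by rewrite mulVf ?normr_eq0.
Qed.

(** * Elements of L(M) and R(M) as module maps *)

(** For fixed h the defect [F] is additive and bounded, hence continuous, and it vanishes on S. [G]
    will be a coordinate projection. *)
Lemma pclosure_commute {R : realType} {M : cstarTernaryType R[i]}
    (S : set (bop M M * bop M M)) (G : bop M M * bop M M -> bop M M) (f : bop M M) :
  {morph G : A B / A + B} -> (forall A, `|G A| <= `|A|) ->
  (forall A, S A -> forall h, G A (f h) = f (G A h)) ->
  forall A, pclosure S A -> forall h, G A (f h) = f (G A h).
Proof.
move=> GD Gle GS A; rewrite pclosureE => SA h.
pose F B := G B (f h) - f (G B h).
suff : closure [set (0 : M)] (F A).
  rewrite -(closure_id [set (0 : M)]).1 => [/subr0_eq//|].
  by apply: accessible_closed_set1; apply: hausdorff_accessible; exact: norm_hausdorff.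
apply: closure_stable SA => [|B SB]; last first.
  by apply: subset_closure; rewrite /= /F GS// subrr.
apply: (@additive_bounded_continuous _ _ _ _ (`|f h| + `|f| * `|h|)) => [B B'||B].
- by rewrite /F GD /= linearD opprD addrACA.
- by rewrite addr_ge0// mulr_ge0.
rewrite (le_trans (ler_normB _ _))// mulrDl lerD//.
  by rewrite (le_trans (opnormP _ _))// mulrC ler_wpM2l//; exact: Gle.
apply: (le_trans (opnormP f (G B h))); rewrite -mulrA ler_wpM2l ?opnorm_ge0//.
apply: (le_trans (opnormP (G B) h)).
by rewrite mulrC ler_wpM2l//; exact: Gle.
Qed.

Lemma norm_fst_le {R : realType} {M : cstarTernaryType R[i]} (A : bop M M * bop M M) :
  `|A.1| <= `|A|.
Proof. by have /andP[] := pair_norms A. Qed.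

Lemma norm_snd_le {R : realType} {M : cstarTernaryType R[i]} (A : bop M M * bop M M) :
  `|A.2| <= `|A|.
Proof. by have /andP[] := pair_norms A. Qed.

(** Both components of a generator are left multiplications, which commute with [.uz] by
    associativity; [pclosure_commute] passes to the closure. *)
Lemma Lset_tp {R : realType} {M : cstarTernaryType R[i]} (A : bop M M * bop M M) (h u z : M) :
  Lset A -> A.1 (tp h u z) = tp (A.1 h) u z /\ A.2 (tp h u z) = tp (A.2 h) u z.
Proof.
move=> LA; pose f := Bop (bounded_op_tpr u z); split.
  apply: (@pclosure_commute _ _ _ fst f _ norm_fst_le _ A LA) => //.
  apply: pspan_ind => [w|B B' BE B'E w|c g k w] /=; first by rewrite tp0l.
    by rewrite tpDl; congr (_ + _); [exact: BE|exact: B'E].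
  by rewrite tpZl tp_assocr.
apply: (@pclosure_commute _ _ _ snd f _ norm_snd_le _ A LA) => //.
apply: pspan_ind => [w|B B' BE B'E w|c g k w] /=; first by rewrite tp0l.
  by rewrite tpDl; congr (_ + _); [exact: BE|exact: B'E].
by rewrite tpZl tp_assocr.
Qed.

Lemma Rset_tp {R : realType} {M : cstarTernaryType R[i]} (A : bop M M * bop M M) (h u z : M) :
  Rset A -> A.1 (tp z u h) = tp z u (A.1 h) /\ A.2 (tp z u h) = tp z u (A.2 h).
Proof.
move=> RA; pose f := Bop (bounded_op_tpl z u); split.
  apply: (@pclosure_commute _ _ _ fst f _ norm_fst_le _ A RA) => //.
  apply: pspan_ind => [w|B B' BE B'E w|c g k w] /=; first by rewrite tpr0.
    by rewrite tpDr; congr (_ + _); [exact: BE|exact: B'E].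
  by change (c *: tp (tp z u w) g k = tp z u (c *: tp w g k)); rewrite tpZr tp_assocr.
apply: (@pclosure_commute _ _ _ snd f _ norm_snd_le _ A RA) => //.
apply: pspan_ind => [w|B B' BE B'E w|c g k w] /=; first by rewrite tpr0.
  by rewrite tpDr; congr (_ + _); [exact: BE|exact: B'E].
by change (c^* *: tp (tp z u w) k g = tp z u (c^* *: tp w k g)); rewrite tpZr tp_assocr.
Qed.

(** * Semisimplicity of the standard embedding *)

Lemma std_embedding_mulr0 {R : realType} (M : cstarTernaryType R[i])
  (X : std_embedding M) : std_embedding_mul X 0 = 0.
Proof.
case: X => [[[A f] g] B].
have l0 : lmul (lval A) 0 = 0.
  by have := lmulDr (lval A) 0 0; rewrite addr0 -[LHS]addr0 => /addrI.
have r0 : rmul (rval B) 0 = 0.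
  by have := rmulDr (rval B) 0 0; rewrite addr0 -[LHS]addr0 => /addrI.
have ell0 : ell f 0 = 0.
  by congr (_, _); apply: bop_eqP => z /=; rewrite ?tp0l ?tp0m.
have rho0 : rho g 0 = 0.
  by congr (_, _); apply: bop_eqP => z /=; rewrite ?tpr0 ?tp0m.
have eL : LElt (Lmem_mul A 0) + LElt (Lmem_ell f 0) = 0 :> Lalg M.
  by apply: val_inj; rewrite raddfD /= l0 ell0 addr0.
have eR : RElt (Rmem_rho g 0) + RElt (Rmem_mul B 0) = 0 :> Ralg M.
  by apply: val_inj; rewrite raddfD /= r0 rho0 addr0.
have -> : 0 = (0, 0, 0, 0) :> std_embedding M by [].
have -> : std_embedding_mul (A, f, g, B) (0, 0, 0, 0) =
  (LElt (Lmem_mul A 0) + LElt (Lmem_ell f 0), (lval A).1 0 + (rval 0).1 f,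
   (lval 0).2 g + (rval B).2 0, RElt (Rmem_rho g 0) + RElt (Rmem_mul B 0)) by [].
by rewrite eL eR !linear0 !addr0.
Qed.

Lemma std_embedding_semisimple {R : realType} (M : cstarTernaryType R[i]) :
  algebra_semisimple (@std_embedding_mul R M).
Proof.
apply/seteqP; split=> [[[[A f] g] B]|X] /=; last first.
  by move=> -> u; exists 0; rewrite subrr !std_embedding_mulr0.
move=> Xr.
have rad0 (x : M) : (forall u, exists y, y - x = tp y u x /\ y - x = tp x u y) -> x = 0.
  by move=> xr; have /seteqP[+ _] := triple_semisimple_cstar M; apply.
have Ltp (A' : Lalg M) h k l : (lval A').1 (tp h k l) = tp ((lval A').1 h) k l /\
    (lval A').2 (tp h k l) = tp ((lval A').2 h) k l.
  by apply: Lset_tp; apply/asboolP; exact: lvalP.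
have Rtp (B' : Ralg M) h k l : (rval B').1 (tp l k h) = tp l k ((rval B').1 h) /\
    (rval B').2 (tp l k h) = tp l k ((rval B').2 h).
  by apply: Rset_tp; apply/asboolP; exact: rvalP.
have f0 : f = 0.
  (* With only the lower left entry u, the upper right entries of XUY and YUX reduce to [f u yf] and
     [yf u f]. *)
  apply: rad0 => u; have [y [yr yl]] := Xr (0, 0, u, 0).
  move/(congr1 (fun Z : std_embedding M => Z.1.1.2)): yr.
  move/(congr1 (fun Z : std_embedding M => Z.1.1.2)): yl.
  move: y => [[[yA yf] yg] yB] yl yr; exists yf; split.
    have -> : yf - f = ((lval yA).1 0 + tp yf u f) + (rval B).1 ((lval yA).1 0 + 0) := yl.
    by rewrite !(linear0, tp0l, tp0m, tpr0, add0r, addr0).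
  have -> : yf - f = ((lval A).1 0 + tp f u yf) + (rval yB).1 ((lval A).1 0 + 0) := yr.
  by rewrite !(linear0, tp0l, tp0m, tpr0, add0r, addr0).
have g0 : g = 0.
  (* In the conjugate space the order is reversed: now XUY gives [yg u g] and YUX gives [g u yg]. *)
  apply: rad0 => u; have [y [yr yl]] := Xr (0, u, 0, 0).
  move/(congr1 (fun Z : std_embedding M => Z.1.2)): yr.
  move/(congr1 (fun Z : std_embedding M => Z.1.2)): yl.
  move: y => [[[yA yf] yg] yB] yl yr; exists yg; split.
    have -> : yg - g = (lval yA).2 (0 + (rval B).2 0) + (tp yg u g + (rval B).2 0) := yr.
    by rewrite !(linear0, tp0l, tp0m, tpr0, add0r, addr0).
  have -> : yg - g = (lval A).2 (0 + (rval yB).2 0) + (tp g u yg + (rval yB).2 0) := yl.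
  by rewrite !(linear0, tp0l, tp0m, tpr0, add0r, addr0).
have A10 h : (lval A).1 h = 0.
  (* At h, the operator [hu.] followed by yA gives [(yA h) u .] by [Ltp], so [yA h] is the witness
     for [A h]. *)
  apply: rad0 => u; have [y [yr yl]] := Xr (LElt (Lmem_ell h u), 0, 0, 0).
  move/(congr1 (fun Z : std_embedding M => (lval Z.1.1.1).1 h)): yr.
  move/(congr1 (fun Z : std_embedding M => (lval Z.1.1.1).1 h)): yl.
  move: y => [[[yA yf] yg] yB] yl yr; exists ((lval yA).1 h); split.
    have -> : (lval yA).1 h - (lval A).1 h =
        ((lval yA).1 (tp h u ((lval A).1 h)) + tp yf 0 ((lval A).1 h))
        + tp ((lval yA).1 0 + 0) g h := yl.
    by rewrite !(linear0, tp0l, tp0m, tpr0, add0r, addr0) (Ltp _ _ _ _).1.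
  have -> : (lval yA).1 h - (lval A).1 h =
      ((lval A).1 (tp h u ((lval yA).1 h)) + tp f 0 ((lval yA).1 h))
      + tp ((lval A).1 0 + 0) yg h := yr.
  by rewrite !(linear0, tp0l, tp0m, tpr0, add0r, addr0) (Ltp _ _ _ _).1.
have A20 h : (lval A).2 h = 0.
  (* The arguments of [ell] are swapped because its second component must be [hu.]. *)
  apply: rad0 => u; have [y [yr yl]] := Xr (LElt (Lmem_ell u h), 0, 0, 0).
  move/(congr1 (fun Z : std_embedding M => (lval Z.1.1.1).2 h)): yr.
  move/(congr1 (fun Z : std_embedding M => (lval Z.1.1.1).2 h)): yl.
  move: y => [[[yA yf] yg] yB] yl yr; exists ((lval yA).2 h); split.
    have -> : (lval yA).2 h - (lval A).2 h =
        (lval yA).2 (tp h u ((lval A).2 h) + tp 0 f h) + tp yg ((lval A).1 0 + 0) h := yr.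
    by rewrite !(linear0, tp0l, tp0m, tpr0, add0r, addr0) (Ltp _ _ _ _).2.
  have -> : (lval yA).2 h - (lval A).2 h =
      (lval A).2 (tp h u ((lval yA).2 h) + tp 0 yf h) + tp g ((lval yA).1 0 + 0) h := yl.
  by rewrite !(linear0, tp0l, tp0m, tpr0, add0r, addr0) (Ltp _ _ _ _).2.
have B10 h : (rval B).1 h = 0.
  (* Mirror image: the first component of the test entry is [.uh], and [Rtp] moves B onto the factor
     h. *)
  apply: rad0 => u; have [y [yr yl]] := Xr (0, 0, 0, RElt (Rmem_rho u h)).
  move/(congr1 (fun Z : std_embedding M => (rval Z.2).1 h)): yr.
  move/(congr1 (fun Z : std_embedding M => (rval Z.2).1 h)): yl.
  move: y => [[[yA yf] yg] yB] yl yr; exists ((rval yB).1 h); split.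
    have -> : (rval yB).1 h - (rval B).1 h =
        tp h (0 + (rval yB).2 0) f + (rval B).1 (tp h yg 0 + tp ((rval yB).1 h) u h) := yl.
    by rewrite !(linear0, tp0l, tp0m, tpr0, add0r, addr0) (Rtp _ _ _ _).1.
  have -> : (rval yB).1 h - (rval B).1 h =
      tp h (0 + (rval B).2 0) yf + (rval yB).1 (tp h g 0 + tp ((rval B).1 h) u h) := yr.
  by rewrite !(linear0, tp0l, tp0m, tpr0, add0r, addr0) (Rtp _ _ _ _).1.
have B20 h : (rval B).2 h = 0.
  apply: rad0 => u; have [y [yr yl]] := Xr (0, 0, 0, RElt (Rmem_rho h u)).
  move/(congr1 (fun Z : std_embedding M => (rval Z.2).2 h)): yr.
  move/(congr1 (fun Z : std_embedding M => (rval Z.2).2 h)): yl.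
  move: y => [[[yA yf] yg] yB] yl yr; exists ((rval yB).2 h); split.
    have -> : (rval yB).2 h - (rval B).2 h =
        tp h yf (0 + (rval B).2 0)
        + (tp ((rval yB).2 h) 0 g + (rval B).2 (tp ((rval yB).2 h) u h)) := yr.
    by rewrite !(linear0, tp0l, tp0m, tpr0, add0r, addr0) (Rtp _ _ _ _).2.
  have -> : (rval yB).2 h - (rval B).2 h =
      tp h f (0 + (rval yB).2 0)
      + (tp ((rval B).2 h) 0 yg + (rval yB).2 (tp ((rval B).2 h) u h)) := yl.
  by rewrite !(linear0, tp0l, tp0m, tpr0, add0r, addr0) (Rtp _ _ _ _).2.
have A0 : A = 0.
  apply: val_inj; rewrite [LHS]surjective_pairing.
  by congr (_, _); apply: bop_eqP => h; [exact: A10|exact: A20].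
have B0 : B = 0.
  apply: val_inj; rewrite [LHS]surjective_pairing.
  by congr (_, _); apply: bop_eqP => h; [exact: B10|exact: B20].
by rewrite A0 f0 g0 B0.
Qed.

Theorem theorem3p9 (R : realType) :
  [/\ forall (M : cstarTernaryType R[i]) (Mp Mm : sub_cstar M),
        zettl_decomposition Mp Mm ->
        algebra_semisimple (@std_embedding_mul R (sub_cstar_type Mm)),
      forall M : cstarTernaryType R[i], triple_semisimple M &
      forall N : cstarTernaryType R[i], anti_TRO_ternary N ->
        algebra_semisimple (@std_embedding_mul R N)].
Proof.
split.
- by move=> M Mp Mm _; exact: std_embedding_semisimple.
- exact: triple_semisimple_cstar.
- by move=> N _; exact: std_embedding_semisimple.
Qed.
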